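(* Let $F_1,\dots,F_k$ be $d\times d$ positive semidefinite matrices with $\sum_{j=1}^kF_j\preceq\mathbb{I}$, let $\lambda\in\mathbb{R}^k$, and let $\ell(\lambda\cdot F)=\operatorname{tr}\exp(\lambda\cdot F)$. Define the $k\times k$ matrices $$\Delta=\sum_j\frac{\partial\ell(\lambda\cdot F)}{\partial\lambda_j}|j\rangle\langle j|,\qquad \Lambda=\sum_{j,j'}\frac{\partial^2\ell(\lambda\cdot F)}{\partial\lambda_j\,\partial\lambda_{j'}}|j\rangle\langle j'|.$$ Then $\Lambda\preceq\Delta$.
   Context: $\lambda\cdot F=\sum_j\lambda_jF_j$. $A\preceq B$ means $B-A$ is positive semidefinite. *)

(* Defs.v *)
From HB Require Import structures.
From mathcomp Require Import all_boot all_order all_algebra.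
From mathcomp Require Import complex.
From mathcomp Require Import all_classical all_reals all_analysis.
Import numFieldNormedType.Exports.
Set Implicit Arguments. Unset Strict Implicit. Unset Printing Implicit Defensive.
Import Order.TTheory GRing.Theory Num.Theory.
Local Open Scope ring_scope.
Local Open Scope complex_scope.

(* Complex d x d matrices over R[i] = complex R, R a realType. *)

(* conjugate transpose *)
Definition adjmx (R : rcfType) m n (A : 'M[R[i]]_(m, n)) : 'M[R[i]]_(n, m) :=
  map_mx (fun z => z^*) A^T.

(* positive semidefinite complex matrix: Hermitian and  v^* A v >= 0 *)
Definition psdC (R : rcfType) d (A : 'M[R[i]]_d) : Prop :=
  adjmx A = A /\ forall v : 'cV[R[i]]_d, 0 <= (adjmx v *m A *m v) 0 0.

(* Loewner order on complex matrices: A <= B iff B - A psd *)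
Definition loewnerC (R : rcfType) d (A B : 'M[R[i]]_d) : Prop := psdC (B - A).

(* positive semidefinite real matrix: symmetric and x^T A x >= 0 *)
Definition psdR (R : realFieldType) k (A : 'M[R]_k) : Prop :=
  A^T = A /\ forall x : 'cV[R]_k, 0 <= (x^T *m A *m x) 0 0.

Definition loewnerR (R : realFieldType) k (A B : 'M[R]_k) : Prop := psdR (B - A).

(* n-th power of a square matrix *)
Definition mxpow (C : pzRingType) d (X : 'M[C]_d) (n : nat) : 'M[C]_d :=
  iter n (mulmx X) 1%:M.

(* tr exp(X) = sum_n tr(X^n)/n!  (real part; real for Hermitian X) *)
Definition trexp (R : realType) d (X : 'M[R[i]]_d) : R :=
  limn (series (fun n : nat => (complex.Re (\tr (mxpow X n)) / (n`!)%:R : R))).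

(* lambda . F = sum_j lambda_j F_j *)
Definition lincomb (R : realType) d k (lam : 'rV[R]_k) (F : 'I_k -> 'M[R[i]]_d)
  : 'M[R[i]]_d := \sum_(j < k) (lam 0 j)%:C *: F j.

(* ell(lambda) = tr exp(lambda . F) *)
Definition ell (R : realType) d k (F : 'I_k -> 'M[R[i]]_d) (lam : 'rV[R]_k) : R :=
  trexp (lincomb lam F).

(* partial derivative of g : R^k -> R in direction j at lam *)
Definition partial (R : realType) k (g : 'rV[R]_k -> R) (j : 'I_k) (lam : 'rV[R]_k) : R :=
  derive1 (fun t : R => g (lam + t *: delta_mx 0 j)) 0.

(* Delta = diag(d ell / d lambda_j) *)
Definition DeltaM (R : realType) d k (F : 'I_k -> 'M[R[i]]_d) (lam : 'rV[R]_k) : 'M[R]_k :=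
  \matrix_(j, j') (if j == j' then partial (ell F) j lam else 0).

(* Lambda = (d^2 ell / d lambda_j d lambda_j') *)
Definition LambdaM (R : realType) d k (F : 'I_k -> 'M[R[i]]_d) (lam : 'rV[R]_k) : 'M[R]_k :=
  \matrix_(j, j') partial (partial (ell F) j') j lam.

(* Main.v *)
Require Import Defs.
From HB Require Import structures.
From mathcomp Require Import all_boot all_order all_algebra.
From mathcomp Require Import complex.
From mathcomp Require Import all_classical all_reals all_analysis.
From mathcomp Require Import ring lra.
Import Order.TTheory GRing.Theory Num.Theory.
Import numFieldNormedType.Exports.
Set Implicit Arguments.
Unset Strict Implicit.
Local Open Scope ring_scope.

(** Write [H = lambda.F].  Differentiating the exponential series termwise gives
    [d_j ell = tr (F_j e^H)], and [d_j d_j' ell] is, in an eigenbasis of [H] with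
    eigenvalues [h_p], the sum over [p, q] of [(F_j')_pq (F_j)_qp L(h_q, h_p)],
    where [L(a, b) = (e^a - e^b) / (a - b)].  For real [x] put
    [X = sum_j x_j F_j].  Since [L(a, b) <= (e^a + e^b) / 2], the quadratic form of
    [Lambda] at [x] is at most [tr (X^2 e^H)].  Finally [sum_j F_j <= 1] gives
    [X^2 <= sum_j x_j^2 F_j], so [tr (X^2 e^H) <= sum_j x_j^2 tr (F_j e^H)], which
    is the quadratic form of [Delta] at [x]. *)

(** * Divided differences of powers and of the exponential *)

Section ScalarExp.
Variable R : realType.
Implicit Types p q u : R.

(** This is (p^n - q^n) / (p - q), written without division so that p = q needs no separate case.
    The recursion copies the product rule for H^n, which lets the two be matched entry by entry
    later. *)
Fixpoint pow_divdiff p q (n : nat) : R :=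
  if n is m.+1 then p * pow_divdiff p q m + q ^+ m else 0.

Lemma pow_divdiffE p q n : (p - q) * pow_divdiff p q n = p ^+ n - q ^+ n.
Proof.
elim: n => [|n IH] /=; first by rewrite !expr0 subrr mulr0.
have -> : (p - q) * (p * pow_divdiff p q n + q ^+ n)
  = p * ((p - q) * pow_divdiff p q n) + (p - q) * q ^+ n by ring.
by rewrite IH !exprS; ring.
Qed.

Lemma pow_divdiff_diag p n : pow_divdiff p p n = n%:R * p ^+ n.-1.
Proof.
elim: n => [|n IH] /=; first by rewrite mul0r.
rewrite IH; case: n {IH} => [|n] /=; first by rewrite !expr0 mul0r mulr0 add0r mulr1.
by rewrite -[in RHS]natr1 exprS; ring.
Qed.

(** The kernel L of the overview, extended to the diagonal by its limit e^p. *)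
Definition exp_divdiff p q : R :=
  if p == q then expR p else (expR p - expR q) / (p - q).

Lemma exp_divdiffC p q : exp_divdiff p q = exp_divdiff q p.
Proof.
rewrite /exp_divdiff (eq_sym q p); case: eqP => [->//|_].
by rewrite -opprB -(opprB q p) invrN mulrNN.
Qed.

Lemma cvg_series_exp_coeff p : (series (exp_coeff p) @ \oo --> expR p)%classic.
Proof. exact: is_cvg_series_exp_coeff. Qed.

(** Absorbs the index shift caused by n / n! = 1 / (n-1)! whenever an exponential series is
    differentiated. *)
Lemma cvg_series_shift (u v : nat -> R) (l : R) :
  u 0%N = 0 -> (forall n, u n.+1 = v n) ->
  (series v @ \oo --> l -> series u @ \oo --> l)%classic.
Proof.
move=> u0 uv cv; rewrite -cvg_shiftS.
rewrite (_ : [sequence _]_n = series v)//; apply/funext => n /=.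
by rewrite /series /= big_nat_recl// u0 add0r; apply: eq_bigr => i _.
Qed.

(** Off the diagonal the series is a multiple of the difference of two exponential series; on it the
    terms are n p^(n-1) / n!, a shifted exponential series. *)
Lemma cvg_exp_divdiff p q :
  (series (fun n => pow_divdiff p q n / n`!%:R) @ \oo --> exp_divdiff p q)%classic.
Proof.
rewrite /exp_divdiff; case: eqVneq => [<-|npq].
  apply: (@cvg_series_shift _ (exp_coeff p)); last exact: cvg_series_exp_coeff.
    by rewrite /= mul0r.
  move=> n; rewrite pow_divdiff_diag /exp_coeff /= factS natrM invfM.
  by rewrite mulrACA divff ?mul1r// pnatr_eq0.
have pq0 : p - q != 0 by rewrite subr_eq0.
have -> : (fun n => pow_divdiff p q n / n`!%:R)
  = (p - q)^-1 *: (exp_coeff p - exp_coeff q).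
  apply/funext => n /=.
  rewrite -[LHS]/(pow_divdiff p q n / n`!%:R)
          -[RHS]/((p - q)^-1 * (exp_coeff p n - exp_coeff q n)).
  by rewrite /exp_coeff /= -mulrBl -pow_divdiffE mulrA mulKf.
rewrite seriesZ seriesD seriesN [(expR p - _) / _]mulrC.
rewrite -[_^-1 * _]/(_^-1 *: (_ : R^o)).
apply: cvgZl_tmp; apply: cvgB; exact: cvg_series_exp_coeff.
Qed.

(** The difference [g] of the two sides vanishes at 0 and has derivative c e^c - e^c + 1, which is
    nonnegative because 1 - c <= e^(-c); the mean value theorem concludes. *)
Lemma expRB1_le u : 0 <= u -> 2 * (expR u - 1) <= u * (expR u + 1).
Proof.
have dgP (x : R) : is_derive x 1 (id * (expR + cst 1) - 2 *: (expR - cst 1) : R -> R)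
    (x * expR x - expR x + 1).
  apply: is_derive_eq; rewrite /GRing.scale /=.
  by rewrite -[(expR + cst 1) x]/(expR x + 1); ring.
move=> u0; pose g : R -> R := id * (expR + cst 1) - 2 *: (expR - cst 1).
have gval x : g x = x * (expR x + 1) - 2 * (expR x - 1) by [].
pose dg (x : R) := x * expR x - expR x + 1.
have gcont : ({within `[0, u], continuous g})%classic.
  by apply: derivable_within_continuous => x _; have [d _] := dgP x; exact: d.
have gder x : x \in `]0, u[%R -> is_derive x 1 g (dg x) by move=> _; exact: dgP.
have [c /[!in_itv] /= /andP[c0 cu]] := MVT_segment u0 gder gcont.
rewrite !gval expR0 mul0r subrr mulr0 !subr0 => gE.
rewrite -subr_ge0 gE mulr_ge0// /dg.
have := expR_ge1Dx (- c); rewrite expRN => h.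
have ec := expR_gt0 c.
have : (1 - c) * expR c <= 1 by rewrite -ler_pdivlMr// div1r.
by lra.
Qed.

(* Hermite-Hadamard for [expR]: the mean over an interval is at most the
   trapezoidal value. *)
Lemma exp_divdiff_le p q : exp_divdiff p q <= (expR p + expR q) / 2.
Proof.
wlog pq : p q / q <= p.
  move=> W; case: (leP q p) => [/W//|/ltW/W].
  by rewrite exp_divdiffC addrC.
rewrite /exp_divdiff; case: eqVneq => [<-|npq]; first by lra.
have lt_qp : 0 < p - q by rewrite subr_gt0 lt_neqAle eq_sym npq.
rewrite ler_pdivrMr//.
have := expRB1_le (ltW lt_qp); rewrite expRB => h.
have eq := expR_gt0 q.
rewrite -(ler_pM2r eq) in h.
have e1 : 2 * (expR p / expR q - 1) * expR q = 2 * (expR p - expR q).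
  by field; rewrite gt_eqF.
have e2 : (p - q) * (expR p / expR q + 1) * expR q = (p - q) * (expR p + expR q).
  by field; rewrite gt_eqF.
by rewrite e1 e2 in h; lra.
Qed.

End ScalarExp.

(** * Termwise differentiation of a series *)

Section SeriesDerivative.
Variable R : realType.

(** A quadratic Taylor remainder with summable constants [M] bounds the error of the n-th difference
    quotient by [M n] times the step, so the summed error tends to 0 with the step. *)
Lemma derive1_series (f : R -> nat -> R) (df M : nat -> R) :
  (forall t n, `|t| <= 1 -> `|f t n - f 0 n - t * df n| <= t ^+ 2 * M n) ->
  cvgn (series M) -> (forall t, cvgn (series (f t))) -> cvgn (series df) ->
  derive1 (fun t => limn (series (f t))) 0 = limn (series df).
Proof.
move=> fM cM cf cdf; apply/cvg_lim; first exact: norm_hausdorff.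
pose g (h : R) := (h^-1 *: (f h - f 0) - df : nat -> R).
have gM h : 0 < `|h| < 1 -> forall n, `|g h n| <= M n * `|h|.
  move=> /andP[h0 h1] n.
  have hn0 : h != 0 by rewrite -normr_gt0.
  have -> : g h n = h^-1 * (f h n - f 0 n - h * df n).
    rewrite -[LHS]/(h^-1 * (f h n - f 0 n) - df n).
    by rewrite [in RHS]mulrBr mulKf.
  rewrite normrM normfV ler_pdivrMl//.
  apply: le_trans (fM _ _ (ltW h1)) _.
  by rewrite -real_normK ?num_real// expr2 mulrA mulrAC mulrC mulrA.
have /= g0 := lim_cvg_to_0_linear (@ltr01 R) cM gM.
apply: (cvg_sub0 _ (cvg_cst _)).
have c1 h : cvgn (series (f h - f 0)) by exact: is_cvg_seriesB.
have c2 h : cvgn (series (h^-1 *: (f h - f 0))) by exact: is_cvg_seriesZ.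
rewrite (_ : _ - _ = fun h => limn (series (g h))); first exact: g0.
apply/funext => h; rewrite /g lim_seriesB// lim_seriesZ// lim_seriesB//.
by rewrite -[LHS]/(h^-1 *: (limn (series (f (h + 0))) - limn (series (f 0)))
  - limn (series df)) addr0.
Qed.

End SeriesDerivative.

Local Open Scope complex_scope.

(** * Real parts and a real-valued norm on complex numbers *)

Section ComplexParts.
Variable R : rcfType.
Implicit Types z w : R[i].

Lemma ReD z w : complex.Re (z + w) = complex.Re z + complex.Re w.
Proof. by case: z; case: w. Qed.

Lemma Re_realM (t : R) z : complex.Re (t%:C * z) = t * complex.Re z.
Proof. by case: z => a b /=; rewrite mul0r subr0. Qed.

Lemma Re_sum (I : Type) (r : seq I) (P : pred I) (f : I -> R[i]) :
  complex.Re (\sum_(i <- r | P i) f i) = \sum_(i <- r | P i) complex.Re (f i).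
Proof. exact: (big_morph _ ReD erefl). Qed.

(** The l1 norm of the pair of real and imaginary parts: it takes values in [R] rather than [R[i]],
    and is still submultiplicative. *)
Definition cnorm1 z : R := `|complex.Re z| + `|complex.Im z|.

Lemma cnorm1D z w : cnorm1 (z + w) <= cnorm1 z + cnorm1 w.
Proof.
case: z w => [a b] [c e]; rewrite /cnorm1 /=.
have := ler_normD a c; have := ler_normD b e; lra.
Qed.

Lemma cnorm1M z w : cnorm1 (z * w) <= cnorm1 z * cnorm1 w.
Proof.
case: z w => [a b] [c e]; rewrite /cnorm1 /=.
have := ler_normB (a * c) (b * e); have := ler_normD (a * e) (b * c).
rewrite !normrM; lra.
Qed.

Lemma cnorm1_realM (t : R) z : cnorm1 (t%:C * z) = `|t| * cnorm1 z.
Proof.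
by case: z => a b; rewrite /cnorm1 /= !mul0r subr0 addr0 !normrM mulrDr.
Qed.

Lemma cnorm1_ge0 z : 0 <= cnorm1 z. Proof. by rewrite addr_ge0. Qed.

Lemma cnorm1_sum (I : Type) (r : seq I) (P : pred I) (f : I -> R[i]) :
  cnorm1 (\sum_(i <- r | P i) f i) <= \sum_(i <- r | P i) cnorm1 (f i).
Proof.
elim/big_ind2: _ => [|x y z t xy zt|//]; first by rewrite /cnorm1 normr0 addr0.
by rewrite (le_trans (cnorm1D _ _))// lerD.
Qed.

End ComplexParts.

(** * The entrywise l1 norm of matrices *)

Section MatrixNorm.
Variable R : rcfType.

Definition mxnorm1 m n (A : 'M[R[i]]_(m, n)) : R := \sum_i \sum_j cnorm1 (A i j).

Lemma mxnorm1_ge0 m n (A : 'M[R[i]]_(m, n)) : 0 <= mxnorm1 A.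
Proof. by apply: sumr_ge0 => i _; apply: sumr_ge0 => j _; exact: cnorm1_ge0. Qed.

Lemma mxnorm1D m n (A B : 'M[R[i]]_(m, n)) :
  mxnorm1 (A + B) <= mxnorm1 A + mxnorm1 B.
Proof.
rewrite -big_split; apply: ler_sum => i _; rewrite -big_split.
by apply: ler_sum => j _; rewrite mxE cnorm1D.
Qed.

Lemma mxnorm1Z m n (t : R) (A : 'M[R[i]]_(m, n)) :
  mxnorm1 (t%:C *: A) = `|t| * mxnorm1 A.
Proof.
rewrite mulr_sumr; apply: eq_bigr => i _; rewrite mulr_sumr.
by apply: eq_bigr => j _; rewrite mxE cnorm1_realM.
Qed.

Lemma mxnorm1M m n p (A : 'M[R[i]]_(m, n)) (B : 'M[R[i]]_(n, p)) :
  mxnorm1 (A *m B) <= mxnorm1 A * mxnorm1 B.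
Proof.
rewrite mulr_suml; apply: ler_sum => i _; rewrite mulr_suml.
apply: (@le_trans _ _ (\sum_j \sum_k cnorm1 (A i k) * cnorm1 (B k j))).
  apply: ler_sum => j _; rewrite mxE (le_trans (cnorm1_sum _ _ _))//.
  by apply: ler_sum => k _; exact: cnorm1M.
rewrite exchange_big; apply: ler_sum => k _ /=.
rewrite -mulr_sumr ler_wpM2l ?cnorm1_ge0//.
rewrite /mxnorm1 (bigD1 k)//= lerDl; apply: sumr_ge0 => l _.
by apply: sumr_ge0 => j _; exact: cnorm1_ge0.
Qed.

Lemma Re_mxtrace_le n (A : 'M[R[i]]_n) : `|complex.Re (\tr A)| <= mxnorm1 A.
Proof.
rewrite /mxtrace Re_sum (le_trans (ler_norm_sum _ _ _))//.
apply: ler_sum => i _; rewrite (bigD1 i)//=.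
rewrite -[leLHS]addr0 lerD//; first by rewrite lerDl.
by apply: sumr_ge0 => j _; exact: cnorm1_ge0.
Qed.

End MatrixNorm.

(** * Derivatives of matrix powers and of trace exponential series *)

Section PowerDerivative.
Variables (R : realType) (d : nat).
Implicit Types A H E : 'M[R[i]]_d.

(* The derivative of [H |-> H ^ n] in direction [E], by the product rule. *)
Fixpoint mxpowD H E (n : nat) : 'M[R[i]]_d :=
  if n is m.+1 then H *m mxpowD H E m + E *m mxpow H m else 0.

Lemma mxpowS H n : mxpow H n.+1 = H *m mxpow H n. Proof. by []. Qed.

(** The identity has norm d rather than 1, so every bound on powers carries this factor from the
    case n = 0. *)
Let c := mxnorm1 (1%:M : 'M[R[i]]_d).

Lemma mxnorm1_mxpow H n : mxnorm1 (mxpow H n) <= c * mxnorm1 H ^+ n.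
Proof.
elim: n => [|n IH]; first by rewrite mulr1.
rewrite mxpowS (le_trans (mxnorm1M _ _))// exprS mulrCA.
by rewrite ler_wpM2l ?mxnorm1_ge0.
Qed.

Let c_ge0 : 0 <= c. Proof. exact: mxnorm1_ge0. Qed.

(** Writing s = h + e, the split s^(n+1) = h s^n + e s^n matches the two terms of the product rule,
    so no factor n appears. *)
Lemma mxnorm1_mxpowD H E n :
  mxnorm1 (mxpowD H E n) <= c * (mxnorm1 H + mxnorm1 E) ^+ n.
Proof.
set h := mxnorm1 H; set e := mxnorm1 E.
have h0 : 0 <= h by exact: mxnorm1_ge0.
have e0 : 0 <= e by exact: mxnorm1_ge0.
elim: n => [|n IH] /=.
  by rewrite mulr1 -[0](scale0r (0 : 'M[R[i]]_d)) (mxnorm1Z 0) normr0 mul0r.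
rewrite (le_trans (mxnorm1D _ _))// exprS mulrDl mulrDr lerD//.
  by rewrite (le_trans (mxnorm1M _ _))// mulrCA ler_wpM2l.
rewrite (le_trans (mxnorm1M _ _))// mulrCA ler_wpM2l//.
rewrite (le_trans (mxnorm1_mxpow _ _))// ler_wpM2l//.
by rewrite lerXn2r ?nnegrE ?addr_ge0// lerDl.
Qed.

Lemma mxnorm1_line_le H E (t : R) : `|t| <= 1 ->
  mxnorm1 (H + t%:C *: E) <= mxnorm1 H + mxnorm1 E.
Proof.
move=> t1; rewrite (le_trans (mxnorm1D _ _))// lerD2l mxnorm1Z.
by rewrite ler_piMl ?mxnorm1_ge0.
Qed.

(** With P and Q the n-th powers of H + tE and H, the next difference of powers is H (P - Q) + t E
    P, which gives the induction. *)
Lemma mxpow_line_lip H E (t : R) n : `|t| <= 1 ->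
  mxnorm1 (mxpow (H + t%:C *: E) n - mxpow H n)
  <= `|t| * (c * (mxnorm1 H + mxnorm1 E) ^+ n).
Proof.
move=> t1; elim: n => [|n IH].
  by rewrite subrr -[0](scale0r (0 : 'M[R[i]]_d)) (mxnorm1Z 0) normr0 mul0r
    mulr_ge0// mulr1.
rewrite !mxpowS mulmxDl -addrA addrCA -mulmxBr addrC -scalemxAl.
rewrite (le_trans (mxnorm1D _ _))// exprS [_ * _ ^+ n]mulrDl !mulrDr lerD//.
  rewrite (le_trans (mxnorm1M _ _))// (mulrCA c) (mulrCA `|t|) ler_wpM2l//.
  exact: mxnorm1_ge0.
rewrite mxnorm1Z ler_wpM2l// (le_trans (mxnorm1M _ _))// mulrCA.
rewrite ler_wpM2l ?mxnorm1_ge0// (le_trans (mxnorm1_mxpow _ _))// ler_wpM2l//.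
by rewrite lerXn2r ?nnegrE ?addr_ge0 ?mxnorm1_ge0// mxnorm1_line_le.
Qed.

Lemma mxpow_line_taylor H E (t : R) n : `|t| <= 1 ->
  mxnorm1 (mxpow (H + t%:C *: E) n - mxpow H n - t%:C *: mxpowD H E n)
  <= t ^+ 2 * (c * (mxnorm1 H + mxnorm1 E) ^+ n).
Proof.
move=> t1; elim: n => [|n IH] /=.
  by rewrite subrr scaler0 subrr -[0](scale0r (0 : 'M[R[i]]_d)) (mxnorm1Z 0)
    normr0 mul0r mulr_ge0// ?sqr_ge0// mulr1.
rewrite -!mxpowS; set P := mxpow (H + _) n in IH *.
set Q := mxpow H n in IH *; set D := mxpowD H E n in IH *.
(* The remainder reproduces itself up to t E (P - Q); the Lipschitz bound on P - Q supplies the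
   second factor t. *)
have -> : mxpow (H + t%:C *: E) n.+1 - mxpow H n.+1 - t%:C *: (H *m D + E *m Q)
  = H *m (P - Q - t%:C *: D) + t%:C *: (E *m (P - Q)).
  rewrite !mxpowS -/P -/Q mulmxDl !mulmxBr scalerDr scalerBr -scalemxAr -scalemxAl.
  rewrite opprD !addrA; congr (_ - _).
  by rewrite [RHS]addrAC; congr (_ - _); rewrite addrAC.
rewrite (le_trans (mxnorm1D _ _))// (exprS (_ + _)) [_ * _ ^+ n]mulrDl !mulrDr lerD//.
  rewrite (le_trans (mxnorm1M _ _))// (mulrCA c) (mulrCA (t ^+ 2)) ler_wpM2l//.
  exact: mxnorm1_ge0.
rewrite mxnorm1Z -real_normK ?num_real// expr2 -mulrA ler_wpM2l//.
rewrite (le_trans (mxnorm1M _ _))// (mulrCA c) (mulrCA `|t|) ler_wpM2l ?mxnorm1_ge0//.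
exact: mxpow_line_lip.
Qed.

(** The n-th term of Re tr (A e^H). The weight [A] lets one family serve both orders of
    differentiation: A = 1 gives [ell], and A = F_j its first partial derivatives. *)
Definition trexp_coeff A H n : R := complex.Re (\tr (A *m mxpow H n)) / n`!%:R.
Definition trexpD_coeff A H E n : R :=
  complex.Re (\tr (A *m mxpowD H E n)) / n`!%:R.

Lemma series_exp_dominated (u : nat -> R) (b h : R) : 0 <= b -> 0 <= h ->
  (forall n, `|u n| <= b * exp_coeff h n) -> cvgn (series u).
Proof.
move=> b0 h0 ub; apply: (@normed_cvg _ R^o).
apply: (@series_le_cvg _ _ (b *: exp_coeff h)) => [n|n|n|].
- exact: normr_ge0.
- by apply: mulr_ge0 => //; exact: exp_coeff_ge0.
- exact: ub.
- by apply: is_cvg_seriesZ; exact: is_cvg_series_exp_coeff.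
Qed.

Lemma Re_tr_fact_le A B (b h : R) n : mxnorm1 B <= b * h ^+ n ->
  `|complex.Re (\tr (A *m B)) / n`!%:R| <= mxnorm1 A * b * exp_coeff h n.
Proof.
move=> Bb; rewrite /exp_coeff /= normrM normfV normr_nat mulrA.
rewrite ler_wpM2r ?invr_ge0// (le_trans (Re_mxtrace_le _))//.
by rewrite (le_trans (mxnorm1M _ _))// -mulrA ler_wpM2l ?mxnorm1_ge0.
Qed.

Lemma is_cvg_trexp A H : cvgn (series (trexp_coeff A H)).
Proof.
apply: (@series_exp_dominated _ (mxnorm1 A * c) (mxnorm1 H)) => [||n].
- by rewrite mulr_ge0// mxnorm1_ge0.
- exact: mxnorm1_ge0.
- by apply: Re_tr_fact_le; exact: mxnorm1_mxpow.
Qed.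

Lemma is_cvg_trexpD A H E : cvgn (series (trexpD_coeff A H E)).
Proof.
apply: (@series_exp_dominated _ (mxnorm1 A * c) (mxnorm1 H + mxnorm1 E)) => [||n].
- by rewrite mulr_ge0// mxnorm1_ge0.
- by rewrite addr_ge0// mxnorm1_ge0.
- by apply: Re_tr_fact_le; exact: mxnorm1_mxpowD.
Qed.

Lemma derive1_trexp A H E :
  derive1 (fun t : R => limn (series (trexp_coeff A (H + t%:C *: E)))) 0
  = limn (series (trexpD_coeff A H E)).
Proof.
(* The Taylor bound divided by n! and by t^2: a multiple of the exponential series at |H| + |E|,
   hence summable. *)
pose M n := mxnorm1 A * c * exp_coeff (mxnorm1 H + mxnorm1 E) n.
apply: (@derive1_series _ _ _ M).
- move=> t n t1; rewrite scale0r addr0 /trexp_coeff /trexpD_coeff.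
  rewrite mulrA -!mulrBl -Re_realM -mxtraceZ.
  have ReB z w : complex.Re (z - w) = complex.Re z - complex.Re w :> R.
    by case: z; case: w.
  rewrite -!ReB -!raddfB /= scalemxAr -!mulmxBr.
  have := mxpow_line_taylor H E n t1; rewrite mulrA => /(Re_tr_fact_le A)/le_trans; apply.
  rewrite [leLHS](_ : _ = t ^+ 2 * M n)//; rewrite /M; ring.
- rewrite (_ : M = (mxnorm1 A * c) *: exp_coeff (mxnorm1 H + mxnorm1 E))//.
  by apply: is_cvg_seriesZ; exact: is_cvg_series_exp_coeff.
- by move=> t; exact: is_cvg_trexp.
- exact: is_cvg_trexpD.
Qed.

(** By cyclicity of the trace all n terms of the product rule contribute equally. The left factor
    H^m is there for the induction, which moves one H into it. At n = 0 the truncated predecessor is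
    harmless, since the factor n vanishes. *)
Lemma mxtrace_mxpowD H E m n :
  \tr (mxpow H m *m mxpowD H E n) = n%:R * \tr (E *m mxpow H (m + n).-1).
Proof.
have powSr k : mxpow H k.+1 = mxpow H k *m H.
  elim: k => [|k IH]; first by rewrite mxpowS /= mulmx1 mul1mx.
  by rewrite mxpowS IH mulmxA -mxpowS IH.
have powD a b : mxpow H a *m mxpow H b = mxpow H (a + b).
  elim: a => [|a IH]; first by rewrite mul1mx.
  by rewrite addSn !mxpowS -mulmxA IH.
elim: n m => [|n IH] m /=; first by rewrite mulmx0 mxtrace0 mul0r.
rewrite mulmxDr mulmxA -powSr mxtraceD IH addSn addnS /=.
rewrite [X in _ + X](_ : _ = \tr (E *m mxpow H (m + n))).
  by rewrite -natr1 mulrDl mul1r.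
by rewrite mxtrace_mulC -mulmxA powD addnC.
Qed.

End PowerDerivative.

(** * Adjoints, positivity, and the bound on the square of a combination *)

Section Adjoint.
Variable R : rcfType.

Lemma adjmxE m n (A : 'M[R[i]]_(m, n)) i j : adjmx A i j = (A j i)^*.
Proof. by rewrite !mxE. Qed.

Lemma adjmx_mul m n p (A : 'M[R[i]]_(m, n)) (B : 'M[R[i]]_(n, p)) :
  adjmx (A *m B) = adjmx B *m adjmx A.
Proof. by rewrite /adjmx trmx_mul map_mxM. Qed.

Lemma adjmxK m n (A : 'M[R[i]]_(m, n)) : adjmx (adjmx A) = A.
Proof. by apply/matrixP => i j; rewrite !adjmxE conjcK. Qed.

Lemma adjmxD m n (A B : 'M[R[i]]_(m, n)) : adjmx (A + B) = adjmx A + adjmx B.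
Proof. by rewrite /adjmx linearD map_mxD. Qed.

Lemma adjmxB m n (A B : 'M[R[i]]_(m, n)) : adjmx (A - B) = adjmx A - adjmx B.
Proof. by rewrite /adjmx linearB map_mxB. Qed.

Lemma adjmx_realZ m n (t : R) (A : 'M[R[i]]_(m, n)) :
  adjmx (t%:C *: A) = t%:C *: adjmx A.
Proof.
by apply/matrixP => i j; rewrite adjmxE 2!mxE adjmxE rmorphM /= oppr0.
Qed.

Lemma adjmx_scalar n (t : R) : adjmx (t%:C%:M : 'M[R[i]]_n) = t%:C%:M.
Proof.
by apply/matrixP => i j; rewrite adjmxE !mxE eq_sym; case: eqP => _;
  rewrite ?mulr1n ?mulr0n ?conjc0 ?conjc_real.
Qed.

Lemma adjmx_lincomb_herm n k (x : 'I_k -> R) (G : 'I_k -> 'M[R[i]]_n) :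
  (forall j, adjmx (G j) = G j) ->
  adjmx (\sum_j (x j)%:C *: G j) = \sum_j (x j)%:C *: G j.
Proof.
move=> hG; rewrite (big_morph (@adjmx R n n) (@adjmxD n n) (id1 := 0)).
  by apply: eq_bigr => j _; rewrite adjmx_realZ hG.
by apply/matrixP => i j; rewrite adjmxE !mxE conjc0.
Qed.

Lemma psdC_congr m n (P : 'M[R[i]]_m) (B : 'M[R[i]]_(m, n)) :
  psdC P -> psdC (adjmx B *m P *m B).
Proof.
move=> [hP posP]; split; first by rewrite !adjmx_mul adjmxK hP mulmxA.
by move=> v; have := posP (B *m v); rewrite adjmx_mul !mulmxA.
Qed.

Lemma psdC_diag_ge0 n (P : 'M[R[i]]_n) i : psdC P -> 0 <= complex.Re (P i i).
Proof.
move=> [_ /(_ (delta_mx i 0))].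
have -> : adjmx (delta_mx i 0 : 'cV[R[i]]_n) = delta_mx 0 i.
  apply/matrixP => a b; rewrite adjmxE !mxE andbC.
  by case: (_ && _); rewrite ?conjc0 ?conjc1.
by rewrite -rowE -colE !mxE; case: (P i i) => a b; rewrite lecE => /andP[].
Qed.

Section LoewnerSquare.
Variables (d k : nat) (G : 'I_k -> 'M[R[i]]_d) (x : 'I_k -> R).
Hypothesis G_psd : forall j, psdC (G j).
Hypothesis G_sum : psdC (1%:M - \sum_j G j).

Let X := \sum_j (x j)%:C *: G j.

(* [Y - X ^ 2], for [Y = \sum_j x_j ^ 2 G_j], is the sum of the positive
   matrices [(X - x_j) G_j (X - x_j)] and [X (1 - \sum_j G_j) X]. *)
Lemma diag_sqr_lincomb_le p :
  complex.Re ((X *m X) p p) <= \sum_j x j ^+ 2 * complex.Re (G j p p).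
Proof.
have Xh : adjmx X = X by apply: adjmx_lincomb_herm => j; have [] := G_psd j.
pose B j := X - (x j)%:C%:M.
have Bh j : adjmx (B j) = B j by rewrite adjmxB Xh adjmx_scalar.
have eqZ : \sum_j ((x j)%:C ^+ 2) *: G j - X *m X =
    \sum_j B j *m G j *m B j + X *m (1%:M - \sum_j G j) *m X.
  have -> : \sum_j B j *m G j *m B j = X *m (\sum_j G j) *m X - X *m X - X *m X
      + \sum_j ((x j)%:C ^+ 2) *: G j.
    have eqB j : B j *m G j *m B j = X *m G j *m X - X *m ((x j)%:C *: G j)
       - ((x j)%:C *: G j) *m X + ((x j)%:C ^+ 2) *: G j.
      rewrite /B mulmxBl mul_scalar_mx mulmxBr mul_mx_scalar mulmxBl.
      rewrite scalerBr scalerA -expr2 -scalemxAr opprB.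
      by rewrite (AC (2*2) ((1*4)*2*3)).
    rewrite (eq_bigr _ (fun j _ => eqB j)) !big_split /= !sumrN.
    by rewrite -mulmx_sumr -!mulmx_suml -mulmx_sumr.
  rewrite mulmxBr mulmxBl mulmx1 -addrA addrCA; congr (_ + _).
  by rewrite [RHS](AC (3*2) ((1*5)*(2*4)*3)) /= subrr addNr !add0r.
have := congr1 (fun Z : 'M[R[i]]_d => complex.Re (Z p p)) eqZ.
have addE (A1 A2 : 'M[R[i]]_d) : (A1 + A2) p p = A1 p p + A2 p p by rewrite mxE.
have oppE (A1 : 'M[R[i]]_d) : complex.Re ((- A1) p p) = - complex.Re (A1 p p).
  by rewrite mxE; case: (A1 p p).
rewrite !addE !ReD oppE !summxE !Re_sum => eqR.
have -> : \sum_j x j ^+ 2 * complex.Re (G j p p)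
   = \sum_j complex.Re (((x j)%:C ^+ 2 *: G j) p p).
  by apply: eq_bigr => j _; rewrite mxE -rmorphXn Re_realM.
rewrite -subr_ge0 eqR addr_ge0//; last first.
  by apply: psdC_diag_ge0; rewrite -{1}Xh; exact: psdC_congr.
apply: sumr_ge0 => j _.
by apply: psdC_diag_ge0; rewrite -{1}Bh; exact: psdC_congr.
Qed.

End LoewnerSquare.
End Adjoint.

(** * Evaluation of the trace series in an eigenbasis *)

Section Diagonalization.
Variables (R : realType) (d : nat).
Implicit Types A E H V : 'M[R[i]]_d.

Lemma hermitian_diagonalization H : adjmx H = H ->
  exists V (h : 'I_d -> R), [/\ adjmx V *m V = 1%:M, V *m adjmx V = 1%:M &
    H = V *m diag_mx (\row_i (h i)%:C) *m adjmx V].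
Proof.
move=> hH; have Hherm : H \is hermsymmx.
  by apply/is_hermitianmxP; rewrite expr0 scale1r -[LHS]hH.
have Hn := hermitian_normalmx Hherm.
have /mxOverP spr := hermitian_spectral_diag_real Hherm.
have := orthomx_spectralP Hn.
have U := spectral_unitarymx H; rewrite (invmx_unitary U) => eqH.
have /unitarymxP UU := U.
pose P := spectralmx H.
have aP : (P ^t* )%sesqui = adjmx P by [].
(* The spectral theorem puts the adjoint of [P] on the left of the diagonal factor, hence this
   choice of [V]. Real parts lose nothing, as a Hermitian matrix has real spectrum. *)
exists (adjmx P), (fun i => complex.Re (spectral_diag H 0 i)).
rewrite adjmxK; split.
- by rewrite -aP.
- by apply: mulmx1C; rewrite -aP.
- rewrite -aP [LHS]eqH; congr (_ *m diag_mx _ *m _).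
  by apply/rowP => i; rewrite mxE RRe_real.
Qed.

Variables (V : 'M[R[i]]_d) (h : 'I_d -> R).
Hypothesis VV : adjmx V *m V = 1%:M.
Hypothesis VV' : V *m adjmx V = 1%:M.

Let H := V *m diag_mx (\row_i (h i)%:C) *m adjmx V.
Let rot A := adjmx V *m A *m V.

Lemma mxpow_diagonalized n :
  mxpow H n = V *m diag_mx (\row_i (h i ^+ n)%:C) *m adjmx V.
Proof.
elim: n => [|n IH].
  rewrite (_ : diag_mx _ = 1%:M) ?mulmx1 ?VV'//.
  by rewrite -diag_const_mx; congr diag_mx; apply/rowP => i; rewrite !mxE.
rewrite mxpowS IH /H -!mulmxA (mulmxA (adjmx V)) VV mul1mx.
congr (_ *m _); rewrite mulmxA mulmx_diag; congr (diag_mx _ *m _).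
by apply/rowP => i; rewrite !mxE exprS rmorphM.
Qed.

(** The Daleckii-Krein formula for powers: in the eigenbasis the derivative is an entrywise product
    with divided differences. The recursion for [mxpowD] multiplies entry (i, j) by h_i and adds
    h_j^n times the entry of E, as [pow_divdiff] does. *)
Lemma mxpowD_diagonalized E n :
  mxpowD H E n = V *m (\matrix_(i, j) (rot E i j * (pow_divdiff (h i) (h j) n)%:C))
                   *m adjmx V.
Proof.
elim: n => [|n IH] /=.
  rewrite (_ : \matrix_(_, _) _ = 0) ?mulmx0 ?mul0mx//.
  by apply/matrixP => i j; rewrite !mxE mulr0.
have VVl m (B : 'M[R[i]]_(d, m)) : adjmx V *m (V *m B) = B by rewrite mulmxA VV mul1mx.
have VVl' m (B : 'M[R[i]]_(d, m)) : V *m (adjmx V *m B) = B by rewrite mulmxA VV' mul1mx.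
rewrite IH mxpow_diagonalized /H.
set D1 := diag_mx _; set D2 := diag_mx _.
set M := (\matrix_(i, j) (rot E i j * (pow_divdiff (h i) (h j) n)%:C)).
have -> : V *m D1 *m adjmx V *m (V *m M *m adjmx V) + E *m (V *m D2 *m adjmx V)
    = V *m (D1 *m M + rot E *m D2) *m adjmx V.
  by rewrite mulmxDr mulmxDl /rot -!mulmxA VVl VVl'.
congr (_ *m _ *m _).
apply/matrixP => i j; rewrite mul_diag_mx mul_mx_diag !mxE.
by rewrite rmorphD /= rmorphM /= mulrDr mulrCA.
Qed.

Lemma mxtrace_rot A B : \tr (A *m (V *m B *m adjmx V)) = \tr (rot A *m B).
Proof. by rewrite /rot !mulmxA mxtrace_mulC !mulmxA. Qed.

Lemma trexp_coeff_diagonalized A n :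
  trexp_coeff A H n = \sum_p complex.Re (rot A p p) * exp_coeff (h p) n.
Proof.
rewrite /trexp_coeff mxpow_diagonalized mxtrace_rot /mxtrace Re_sum mulr_suml.
apply: eq_bigr => p _.
rewrite mul_mx_diag mxE [X in complex.Re (_ * X)]mxE [X in complex.Re X]mulrC Re_realM.
by rewrite mulrAC mulrC.
Qed.

Lemma trexpD_coeff_diagonalized A E n :
  trexpD_coeff A H E n = \sum_p \sum_q complex.Re (rot A p q * rot E q p) *
    (pow_divdiff (h q) (h p) n / n`!%:R).
Proof.
rewrite /trexpD_coeff mxpowD_diagonalized mxtrace_rot /mxtrace Re_sum mulr_suml.
apply: eq_bigr => p _; rewrite mxE Re_sum mulr_suml; apply: eq_bigr => q _.
rewrite (_ : fun_of_matrix (\matrix_(_, _) _) q p =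
  rot E q p * (pow_divdiff (h q) (h p) n)%:C); last by rewrite mxE.
by rewrite [X in complex.Re X]mulrA [X in complex.Re X]mulrC Re_realM mulrAC mulrC.
Qed.

Lemma cvg_series_lincomb (I : Type) (r : seq I) (w : I -> R) (u : I -> nat -> R)
  (l : I -> R) : (forall i, series (u i) @ \oo --> l i)%classic ->
  (series (fun n => \sum_(i <- r) w i * u i n) @ \oo --> \sum_(i <- r) w i * l i)%classic.
Proof.
move=> ul; elim: r => [|i r IH].
  rewrite big_nil (_ : series _ = cst 0); first exact: cvg_cst.
  by apply/funext => n; rewrite /series /= big1// => i _; rewrite big_nil.
rewrite big_cons (_ : series _ = (w i *: series (u i)) +
    series (fun n => \sum_(j <- r) w j * u j n)).
  by apply: cvgD IH; apply: (@cvgZl_tmp _ R^o); exact: ul.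
rewrite -seriesZ -seriesD; congr series; apply/funext => n.
by rewrite big_cons.
Qed.

Lemma lim_trexp A : limn (series (trexp_coeff A H)) =
  \sum_p complex.Re (rot A p p) * expR (h p).
Proof.
apply/cvg_lim; first exact: norm_hausdorff.
rewrite (_ : trexp_coeff A H = fun n => \sum_p complex.Re (rot A p p) * exp_coeff (h p) n).
  by apply: cvg_series_lincomb => p; exact: cvg_series_exp_coeff.
by apply/funext => n; exact: trexp_coeff_diagonalized.
Qed.

Lemma lim_trexpD A E : limn (series (trexpD_coeff A H E)) =
  \sum_p \sum_q complex.Re (rot A p q * rot E q p) * exp_divdiff (h q) (h p).
Proof.
apply/cvg_lim; first exact: norm_hausdorff.
(* The double sum becomes one sum over pairs, so that the limit of a finite combination of series
   applies. *)
rewrite pair_bigA (_ : trexpD_coeff A H E = fun n => \sum_pq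
    complex.Re (rot A pq.1 pq.2 * rot E pq.2 pq.1) *
    (pow_divdiff (h pq.2) (h pq.1) n / n`!%:R)).
  apply: (cvg_series_lincomb (u := fun pq n => pow_divdiff (h pq.2) (h pq.1) n / n`!%:R)
    (l := fun pq => exp_divdiff (h pq.2) (h pq.1))) => pq.
  exact: cvg_exp_divdiff.
by apply/funext => n; rewrite trexpD_coeff_diagonalized pair_bigA.
Qed.

End Diagonalization.

(** * First and second partial derivatives of [ell] *)

Section TraceExpDerivatives.
Variables (R : realType) (d k : nat) (F : 'I_k -> 'M[R[i]]_d).

Lemma lincomb_line (lam : 'rV[R]_k) (t : R) j :
  lincomb (lam + t *: delta_mx 0 j) F = lincomb lam F + t%:C *: F j.
Proof.
rewrite /lincomb.
under eq_bigr do rewrite !mxE eqxx /= rmorphD scalerDl.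
rewrite big_split /=; congr (_ + _).
rewrite (bigD1 j)//= eqxx mulr1 big1 ?addr0//.
by move=> l /negPf ->; rewrite mulr0 scale0r.
Qed.

Lemma ellE (lam : 'rV[R]_k) :
  ell F lam = limn (series (trexp_coeff 1%:M (lincomb lam F))).
Proof.
rewrite /ell /trexp; congr (limn (series _)); apply/funext => n.
by rewrite /trexp_coeff mul1mx.
Qed.

Lemma partial_trexp A (lam : 'rV[R]_k) j :
  partial (fun mu => limn (series (trexp_coeff A (lincomb mu F)))) j lam
  = limn (series (trexpD_coeff A (lincomb lam F) (F j))).
Proof.
have eqf : (fun t : R => limn (series (trexp_coeff A (lincomb (lam + t *: delta_mx 0 j) F))))
    = fun t => limn (series (trexp_coeff A (lincomb lam F + t%:C *: F j))).
  by apply/funext => t; rewrite lincomb_line.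
by move: (derive1_trexp A (lincomb lam F) (F j)); rewrite -eqf.
Qed.

Lemma partial_ell (lam : 'rV[R]_k) j :
  partial (ell F) j lam = limn (series (trexp_coeff (F j) (lincomb lam F))).
Proof.
rewrite (_ : ell F = fun mu => limn (series (trexp_coeff 1%:M (lincomb mu F)))).
  rewrite partial_trexp; apply/cvg_lim; first exact: norm_hausdorff.
  (* With weight 1, term n+1 of the differentiated series is (n+1) tr (F_j H^n) / (n+1)!, that is,
     term n of tr (F_j e^H); term 0 is zero. *)
  apply: (@cvg_series_shift _ _ (trexp_coeff (F j) (lincomb lam F))) => [|n|].
  - by rewrite /trexpD_coeff /= mulmx0 mxtrace0 mul0r.
  - have := mxtrace_mxpowD (lincomb lam F) (F j) 0 n.+1.
    rewrite /trexpD_coeff /trexp_coeff add0n /= => ->.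
    rewrite -(rmorph_nat (real_complex R)) Re_realM factS natrM invfM.
    by rewrite mulrACA divff ?mul1r// pnatr_eq0.
  - exact: is_cvg_trexp.
by apply/funext => mu; exact: ellE.
Qed.

Lemma partial2_ell (lam : 'rV[R]_k) j j' :
  partial (partial (ell F) j') j lam
  = limn (series (trexpD_coeff (F j') (lincomb lam F) (F j))).
Proof.
have -> : partial (ell F) j' = fun mu => limn (series (trexp_coeff (F j') (lincomb mu F))).
  by apply/funext => mu; exact: partial_ell.
exact: partial_trexp.
Qed.

End TraceExpDerivatives.

(** * Comparison of the two quadratic forms *)

Lemma sum_exp_divdiff_le (R : realType) d (X : 'M[R[i]]_d) (h : 'I_d -> R) :
  adjmx X = X ->
  \sum_p \sum_q complex.Re (X p q * X q p) * exp_divdiff (h q) (h p)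
  <= \sum_p complex.Re ((X *m X) p p) * expR (h p).
Proof.
move=> Xh.
pose w p q := complex.Re (X p q * X q p).
have w0 p q : 0 <= w p q.
  (* Since [X] is Hermitian, [w p q] is the squared modulus of X_pq. *)
  rewrite /w -[in X q p]Xh adjmxE; case: (X p q) => a b /=.
  by rewrite mulrN opprK addr_ge0// -expr2 sqr_ge0.
have wC p q : w p q = w q p by rewrite /w mulrC.
have -> : \sum_p complex.Re ((X *m X) p p) * expR (h p)
   = \sum_p \sum_q w p q * expR (h p).
  by apply: eq_bigr => p _; rewrite mxE Re_sum mulr_suml.
apply: (@le_trans _ _ (\sum_p \sum_q w p q * ((expR (h q) + expR (h p)) / 2))).
  by do 2 (apply: ler_sum => ? _); apply: ler_wpM2l; [exact: w0 | exact: exp_divdiff_le].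
(* The weights are symmetric, so both halves of the trapezoidal bound have the same sum. *)
have eqs : \sum_p \sum_q w p q * expR (h q) = \sum_p \sum_q w p q * expR (h p).
  rewrite exchange_big; apply: eq_bigr => p _; apply: eq_bigr => q _.
  by rewrite wC.
rewrite [leLHS](_ : _ = (\sum_p \sum_q w p q * expR (h q) +
    \sum_p \sum_q w p q * expR (h p)) / 2); first by rewrite eqs; lra.
rewrite -big_split mulr_suml; apply: eq_bigr => p _ /=.
rewrite -big_split mulr_suml; apply: eq_bigr => q _ /=.
by rewrite -mulrDr mulrA.
Qed.

Lemma quadratic_formE (R : realFieldType) k (M : 'M[R]_k) (x : 'cV[R]_k) :
  (x^T *m M *m x) 0 0 = \sum_j \sum_j' x j 0 * x j' 0 * M j j'.
Proof.
rewrite mxE exchange_big; apply: eq_bigr => j' _.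
rewrite mxE mulr_suml; apply: eq_bigr => j _.
by rewrite mxE mulrAC.
Qed.

Unset Implicit Arguments.
Set Strict Implicit.

Theorem theoremC4 (R : realType) (d k : nat) (F : 'I_k -> 'M[R[i]]_d)
  (hpsd : forall j, psdC (F j))
  (hsum : loewnerC (\sum_(j < k) F j) 1%:M)
  (lam : 'rV[R]_k) :
  loewnerR (LambdaM F lam) (DeltaM F lam).
Proof.
have Fh j : adjmx (F j) = F j by have [] := hpsd j.
have Hh : adjmx (lincomb lam F) = lincomb lam F by exact: adjmx_lincomb_herm.
have [V [h [VV VV' eqH]]] := hermitian_diagonalization Hh.
(* The F_j in the eigenbasis of H; both hypotheses survive congruence by the unitary [V]. *)
pose G j := adjmx V *m F j *m V.
have G_psd j : psdC (G j) by exact: psdC_congr.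
have G_sum : psdC (1%:M - \sum_j G j).
  have := psdC_congr V hsum.
  by rewrite mulmxBr mulmxBl mulmx1 VV mulmx_sumr mulmx_suml.
have LambdaE j j' : LambdaM F lam j j' =
    \sum_p \sum_q complex.Re (G j' p q * G j q p) * exp_divdiff (h q) (h p).
  by rewrite mxE partial2_ell eqH (lim_trexpD h VV VV').
have DeltaE j j' : DeltaM F lam j j' =
    if j == j' then \sum_p complex.Re (G j p p) * expR (h p) else 0.
  by rewrite mxE partial_ell eqH (lim_trexp h VV VV').
have subE (A B : 'M[R]_k) j j' : (A - B) j j' = A j j' - B j j'.
  by rewrite mxE [X in _ + X]mxE.
split.
  apply/matrixP => j j'; rewrite mxE !subE.
  congr (_ - _); first by rewrite (DeltaE j' j) (DeltaE j j'); case: (eqVneq j j') => [->|].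
  (* Exchanging j and j' amounts to exchanging p and q, under which the kernel L is symmetric. *)
  rewrite (LambdaE j' j) (LambdaE j j') [LHS]exchange_big.
  apply: eq_bigr => p _; apply: eq_bigr => q _.
  by rewrite [X in complex.Re X]mulrC exp_divdiffC.
move=> x; rewrite quadratic_formE.
pose X := \sum_j (x j 0)%:C *: G j.
have Xh : adjmx X = X by apply: adjmx_lincomb_herm => j; have [] := G_psd j.
have -> : \sum_j \sum_j' x j 0 * x j' 0 * (DeltaM F lam - LambdaM F lam) j j'
   = \sum_j \sum_j' x j 0 * x j' 0 * DeltaM F lam j j'
   - \sum_j \sum_j' x j 0 * x j' 0 * LambdaM F lam j j'.
  rewrite -sumrB; apply: eq_bigr => j _; rewrite -sumrB; apply: eq_bigr => j' _.
  by rewrite subE mulrBr.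
rewrite subr_ge0.
(* By bilinearity the form of Lambda at x is the second derivative of [ell] in the single direction
   [X]; the sums over p and q are moved outside one at a time. *)
have -> : \sum_j \sum_j' x j 0 * x j' 0 * LambdaM F lam j j' =
  \sum_p \sum_q complex.Re (X p q * X q p) * exp_divdiff (h q) (h p).
  transitivity (\sum_j \sum_j' \sum_p \sum_q
     x j 0 * x j' 0 * complex.Re (G j' p q * G j q p) * exp_divdiff (h q) (h p)).
    apply: eq_bigr => j _; apply: eq_bigr => j' _; rewrite LambdaE mulr_sumr.
    by apply: eq_bigr => p _; rewrite mulr_sumr; apply: eq_bigr => q _; rewrite mulrA.
  under eq_bigr do rewrite exchange_big.
  rewrite exchange_big; apply: eq_bigr => p _ /=.
  under eq_bigr do rewrite exchange_big.
  rewrite exchange_big; apply: eq_bigr => q _ /=.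
  rewrite exchange_big /= /X !summxE mulr_suml Re_sum mulr_suml.
  apply: eq_bigr => j' _; rewrite mulr_sumr Re_sum mulr_suml.
  apply: eq_bigr => j _; congr (_ * _).
  by rewrite [X in _ = complex.Re (X * _)]mxE [X in _ = complex.Re (_ * X)]mxE
    mulrACA -rmorphM Re_realM [in RHS](mulrC (x j' 0)).
have -> : \sum_j \sum_j' x j 0 * x j' 0 * DeltaM F lam j j' =
  \sum_p (\sum_j x j 0 ^+ 2 * complex.Re (G j p p)) * expR (h p).
  under [RHS]eq_bigr do rewrite mulr_suml.
  rewrite [RHS]exchange_big; apply: eq_bigr => j _.
  rewrite (bigD1 j)//= big1 => [|j' /negPf ne]; last first.
    by rewrite DeltaE eq_sym ne mulr0.
  rewrite addr0 DeltaE eqxx mulr_sumr; apply: eq_bigr => p _.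
  by rewrite mulrA expr2.
(* The trapezoidal bound leaves the diagonal of X^2 weighted by e^(h_p) >= 0, so it suffices to
   compare the diagonal entries of X^2 and of the sum of x_j^2 G_j. *)
apply: le_trans (sum_exp_divdiff_le h Xh) _.
apply: ler_sum => p _; rewrite ler_wpM2r ?expR_ge0//.
exact: (diag_sqr_lincomb_le (fun j => x j 0) G_psd G_sum p).
Qed.
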